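(* Consider a planar directed network on a disc with $n_1+m$ sources separated from $m+n_2$ sinks, let $\mathcal M$ be its quantum transport matrix with entries in $Q$, and let $M_{11}$ ($m\times n_1$), $M_{12}$ ($m\times m$), $M_{21}$ ($n_2\times n_1$), $M_{22}$ ($n_2\times m$) be its blocks. Assume that the quantum transport matrix $M_{12}$ is invertible. Put $$T^+_0=M_{21},\qquad T^+_k=M_{22}M_{12}^{k-1}M_{11}\ (k\ge 1),\qquad T^-_k=M_{22}M_{12}^{-k}M_{11}-\delta_{k,1}M_{21}\ (k\ge 1),$$ and $T^+(u)=\sum_{k\ge 0}T^+_ku^{-k}$, $T^-(u)=\sum_{k\ge 1}T^-_ku^{k}$. Then these satisfy the quantum loop algebra relations $$R(u,v)\overset{1}{T}{}^+(u)\overset{2}{T}{}^+(v)=\overset{2}{T}{}^+(v)\overset{1}{T}{}^+(u)R(u,v),$$ $$R(u,v)\overset{1}{T}{}^+(u)\overset{2}{T}{}^-(v)=\overset{2}{T}{}^-(v)\overset{1}{T}{}^+(u)R(u,v),$$ $$R(u,v)\overset{1}{T}{}^-(u)\overset{2}{T}{}^-(v)=\overset{2}{T}{}^-(v)\overset{1}{T}{}^-(u)R(u,v),$$ where $R(u,v)=uR^{-\mathrm T}-vR$. In particular, the elements $T^+_0$ and $T^-_1$ constitute a subalgebra: $$R\overset{1}{T}{}^+_0\overset{2}{T}{}^+_0=\overset{2}{T}{}^+_0\overset{1}{T}{}^+_0R\quad\text{or}\quad R^{-\mathrm T}\overset{1}{T}{}^+_0\overset{2}{T}{}^+_0=\overset{2}{T}{}^+_0\overset{1}{T}{}^+_0R^{-\mathrm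 T},$$ $$R\overset{1}{T}{}^-_1\overset{2}{T}{}^+_0=\overset{2}{T}{}^+_0\overset{1}{T}{}^-_1R,$$ $$R\overset{1}{T}{}^-_1\overset{2}{T}{}^-_1=\overset{2}{T}{}^-_1\overset{1}{T}{}^-_1R\quad\text{or}\quad R^{-\mathrm T}\overset{1}{T}{}^-_1\overset{2}{T}{}^-_1=\overset{2}{T}{}^-_1\overset{1}{T}{}^-_1R^{-\mathrm T}$$ (here ''or'' separates two equivalent forms, both of which hold).
   Context: **Network and quantum transport matrix.** Let $q\in\mathbb C^*$ (with a fixed choice of $q^{1/2}$). A planar directed network on a disc is a directed graph embedded in the disc with finitely many boundary univalent vertices (sources, with the edge directed inwards, and sinks, with the edge directed outwards) and inner trivalent vertices having either one incoming and two outgoing edges (''gray'') or two incoming and one outgoing edge (''black''); directed cycles are allowed. To every face (inner or boundary) $i$ of the network a variable $\omega_i$ is assigned, with $q^{\varepsilon_{ij}}\omega_i\omega_j=q^{-\varepsilon_{ij}}\omega_j\omega_i$, where $\varepsilon_{ij}=-\varepsilon_{ji}$ is the exchange matrix of the dual quiver: $\varepsilon$ is the sum over inner vertices of contributions $\varepsilon_{XY}=\varepsilon_{YZ}=\varepsilon_{ZX}=\tfrac12$ (antisymmetrized), where $X,Y,Z$ are the three faces around the vertex listed clockwise for a gray vertex and counterclockwise for a black vertex. $Q$ denotes the algebra (skew field of fractions of the quantum torus, or a suitable completion) containing all the $\omega_i$. The Weyl-ordered product is $:\!\omega_{i_1}\cdots\omega_{i_r}\!:\;=q^{\sum_{a<b}\varepsilon_{i_ai_b}}\omega_{i_1}\cdots\omega_{i_r}$.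 For a source $a$ and a sink $c$, $$T_{a\to c}=\sum_{\text{directed paths } a\to c}(-1)^{\#\text{self-intersections}}\; :\!\prod_{\text{faces to the right of the path}}\omega_i\!:\ ,$$ where paths with repetitions and self-intersections are included and faces are counted with multiplicity; for networks with cycles the sum may be infinite and is understood as the resulting rational expression. All sources are separated from all sinks along the boundary of the disc. There are $n_1+m$ sources, ordered clockwise (first $n_1$, then $m$), and $m+n_2$ sinks, ordered counterclockwise (first $m$, then $n_2$). With $\mathcal M_{i,j}=T_{a_j\to c_i}$, the $(m+n_2)\times(n_1+m)$ transport matrix has the block form $\mathcal M=\begin{pmatrix}M_{11}&M_{12}\\ M_{21}&M_{22}\end{pmatrix}$ with row blocks of sizes $m,n_2$ and column blocks of sizes $n_1,m$. **$R$-matrix.** For each size $k$, $$R=R_k=\sum_{1\le i,j\le k}e_{ii}\otimes e_{jj}+(q-1)\sum_{1\le i\le k}e_{ii}\otimes e_{ii}+(q-q^{-1})\sum_{1\le j<i\le k}e_{ij}\otimes e_{ji},$$ acting on $V_k\otimes V_k$, $V_k=\mathbb C^k$. $R^{\mathrm T}$ is the total transpose and $R^{-\mathrm T}=(R^{-1})^{\mathrm T}$. It is an established fact (standing input) that the quantum transport matrix satisfies $$R_{m+n_2}\overset{1}{\mathcal M}\overset{2}{\mathcal M}=\overset{2}{\mathcal M}\overset{1}{\mathcal M}R_{n_1+m}.$$ **Conventions.** A number over a matrix indicates the tensor factor in which it acts (e.g. $\overset{1}{M}=\sum e_{ij}\otimes I\otimes M_{ij}$). Entries in $Q$ are multiplied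 in the order in which the matrices are written. The entries of $R$ are scalars; its size is determined by the position: it acts on $V_{n_2}\otimes V_{n_2}$ to the left of products of $T^\pm$'s and on $V_{n_1}\otimes V_{n_1}$ to the right. Invertibility of $M_{12}$ means existence of the inverse $m\times m$ matrix $M_{12}^{-1}$ with operator entries, $M_{12}M_{12}^{-1}=M_{12}^{-1}M_{12}=\mathbf I$. Relations containing $u,v$ are identities of formal series in $u,v$ (coefficientwise). *)

(* Defs.v *)
From HB Require Import structures.
From mathcomp Require Import all_boot all_order all_algebra.
From mathcomp Require Import boolp classical_sets reals.
From mathcomp Require Import complex mxtens.

Set Implicit Arguments.
Unset Strict Implicit.
Unset Printing Implicit Defensive.

Import Order.TTheory GRing.Theory Num.Theory.
Local Open Scope ring_scope.

(** * Planar directed networks on a disc *)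

(* Combinatorial data of an embedded network.  The disc is drawn with all
   sources on its left and all sinks on its right; sources are numbered
   clockwise and sinks counterclockwise, that is, both from bottom to top, and
   the two groups are separated on the boundary.  "Left" and "right" are always
   relative to the direction of travel along an edge.
   - a gray vertex has the incoming edge [gin] and the outgoing edges [gl], [gr]
     leaving to the left and to the right;
   - a black vertex has the incoming edges [bl], [br] joining from the left and
     from the right, and the outgoing edge [bout];
   - [lf e], [rf e] are the faces on the left and on the right of the edge [e];
   - [sarc i] is the face along the boundary arc just below the [i]-th source,
     [sarc ns] the one above the last source, and similarly for [tarc] and
     sinks (values beyond [ns], [nt] are irrelevant).
   The first two axioms say that every edge has exactly one tail and exactly one
   head, the others that the faces agree in each corner at a vertex. *)
Record diagram (ns nt : nat) := Diagram {
  gray : finType;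
  black : finType;
  edge : finType;
  face : finType;
  src : 'I_ns -> edge;
  snk : 'I_nt -> edge;
  gin : gray -> edge;
  gl : gray -> edge;
  gr : gray -> edge;
  bl : black -> edge;
  br : black -> edge;
  bout : black -> edge;
  lf : edge -> face;
  rf : edge -> face;
  sarc : nat -> face;
  tarc : nat -> face;
  tail_bij : bijective (fun t : 'I_ns + (gray + gray + black) =>
    match t with
    | inl i => src i
    | inr (inl (inl v)) => gl v
    | inr (inl (inr v)) => gr v
    | inr (inr v) => bout v
    end);
  head_bij : bijective (fun t : 'I_nt + (gray + (black + black)) =>
    match t with
    | inl i => snk i
    | inr (inl v) => gin v
    | inr (inr (inl v)) => bl v
    | inr (inr (inr v)) => br v
    end);
  gray_corners : forall v,
    [/\ lf (gl v) = lf (gin v), lf (gr v) = rf (gl v) & rf (gr v) = rf (gin v)];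
  black_corners : forall v,
    [/\ lf (bl v) = lf (bout v), lf (br v) = rf (bl v) & rf (br v) = rf (bout v)];
  src_arcs : forall i, rf (src i) = sarc i /\ lf (src i) = sarc i.+1;
  snk_arcs : forall i, rf (snk i) = tarc i /\ lf (snk i) = tarc i.+1;
  bottom_arc : sarc 0 = tarc 0;
  top_arc : sarc ns = tarc nt
}.

Section Planarity.
Variables (ns nt : nat) (D : diagram ns nt).

(* In [option (edge D)], [None] stands for the boundary circle of the disc. *)
Definition on_boundary (x : option (edge D)) : bool :=
  if x is Some e then [exists i, e == src D i] || [exists i, e == snk D i]
  else true.

Definition share_vertex (x y : option (edge D)) : bool :=
  (on_boundary x && on_boundary y) ||
  match x, y with
  | Some e, Some f =>
      [exists v : gray D, (e \in [:: gin v; gl v; gr v])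
                          && (f \in [:: gin v; gl v; gr v])] ||
      [exists v : black D, (e \in [:: bl v; br v; bout v])
                          && (f \in [:: bl v; br v; bout v])]
  | _, _ => false
  end.

Definition faces_at (x : option (edge D)) : seq (face D) :=
  if x is Some e then [:: lf e; rf e]
  else [seq sarc D i | i <- iota 0 ns.+1] ++ [seq tarc D i | i <- iota 0 nt.+1].

Definition touching (x y : option (edge D)) : bool :=
  share_vertex x y || has [in faces_at x] (faces_at y).

(* Euler's formula V - E + F = C + 1 for the embedded graph on the sphere made
   of the network and of the boundary circle; the [ns + nt] boundary vertices
   cancel against the [ns + nt] boundary arcs, and the outside of the disc
   accounts for the 1.  [C] counts the connected components, the boundary circle
   and everything attached to it being one of them.  Since the data is
   connected through vertices and faces, the left-hand side is always at most
   the right-hand side, with equality exactly when the data comes from an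
   embedding in the disc with set of faces [face D]. *)
Definition planar : Prop :=
  [/\ forall f : face D, exists x, f \in faces_at x,
      forall x y, connect touching x y
    & (#|gray D| + #|black D| + #|face D| =
         #|edge D| + n_comp share_vertex (predT : pred (option (edge D))))%N].

End Planarity.

Record network (ns nt : nat) := Network {
  diag :> diagram ns nt;
  planarP : planar diag
}.

Section Transport.
Variables (ns nt : nat) (N : network ns nt).

Local Notation edge := (edge N).
Local Notation face := (face N).

(* The exchange matrix takes values in Z/2; we store 2 * epsilon.  The faces
   X, Y, Z around a gray vertex are listed clockwise from the left of the
   incoming edge, those around a black vertex counterclockwise from the left of
   the outgoing edge. *)
Definition arrows (f g : face) : int :=
  let tri x y z : int :=
    ((f == x) && (g == y))%:Z + ((f == y) && (g == z))%:Z
      + ((f == z) && (g == x))%:Z in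
  \sum_(v : gray N) tri (lf (gin v)) (rf (gl v)) (rf (gin v))
  + \sum_(v : black N) tri (lf (bout v)) (rf (bl v)) (rf (bout v)).

Definition eps2 (f g : face) : int := arrows f g - arrows g f.

Definition follows : rel edge := fun e f =>
  [exists v : gray N, (e == gin v) && (f \in [:: gl v; gr v])] ||
  [exists v : black N, (e \in [:: bl v; br v]) && (f == bout v)].

Definition is_path (a : 'I_ns) (c : 'I_nt) (p : seq edge) : bool :=
  if p is e :: p' then
    [&& e == src N a, path follows e p' & last e p' == snk N c]
  else false.

(* Two passages of a path through the same place share a maximal common run
   e_(i+1) .. e_(i+k) = e_(j+1) .. e_(j+k) of edges; they join at a black vertex
   and separate at a gray one, and they cross when the passage joining from the
   left leaves to the right. *)
Definition self_intersections (p : seq edge) : nat :=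
  if p is e0 :: _ then
    let e := nth e0 p in
    #|[pred t : 'I_(size p) * 'I_(size p) * 'I_(size p) |
        let i := val t.1.1 in let j := val t.1.2 in let k := val t.2 in
        [&& (i < j)%N, (0 < k)%N, (j + k.+1 < size p)%N,
            e i != e j,
            all (fun l => e (i + l)%N == e (j + l)%N) (iota 1 k),
            e (i + k.+1)%N != e (j + k.+1)%N &
            [exists v, e i == bl v] != [exists v, e (i + k.+1)%N == gl v]]]|
  else 0%N.

(* Multiplicities with which the faces lie to the right of the path [p]: the
   multiplicity is 0 at the face above all sources and sinks, which is on the
   left of every path, and increases by 1 whenever one crosses the path from
   left to right.  It can be negative inside counterclockwise loops. *)
Definition right_mult_spec (p : seq edge) (mu : {ffun face -> int}) : Prop :=
  mu (sarc N ns) = 0 /\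
  forall e : edge, mu (rf e) = mu (lf e) + (count_mem e p)%:Z.

Definition right_mult (p : seq edge) : {ffun face -> int} :=
  xget [ffun=> 0] (right_mult_spec p).

Variables (C : fieldType) (Q : unitAlgType C).
(* [s] is the chosen square root of q, so that q ^ eps = s ^ eps2. *)
Variables (s : C) (w : face -> Q).

Definition face_variables : Prop :=
  (forall f, w f \is a GRing.unit) /\
  (forall f g, s ^ (eps2 f g) *: (w f * w g) = s ^ (- eps2 f g) *: (w g * w f)).

(* Weyl-ordered product of the powers w f ^ k, for (f, k) in [l]. *)
Fixpoint weyl_exponent (l : seq (face * int)) : int :=
  if l is (f, k) :: l' then
    \sum_(x <- l') eps2 f x.1 * k * x.2 + weyl_exponent l'
  else 0.

Definition weyl (l : seq (face * int)) : Q :=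
  s ^ (weyl_exponent l) *: \prod_(x <- l) w x.1 ^ x.2.

Definition path_weight (p : seq edge) : Q :=
  (-1) ^+ self_intersections p *: weyl [seq (f, right_mult p f) | f <- enum face].

Definition path_sum (a : 'I_ns) (c : 'I_nt) (n : nat) : Q :=
  \sum_(p : n.-tuple edge | is_path a c p) path_weight p.

End Transport.

(* [x] is the value of the (possibly infinite) sum of the [a n] as a rational
   expression: the power series sum_n (a n) t^n, with t central, is a fraction
   P S^-1 of polynomials in t with S(1) invertible, and x = P(1) S(1)^-1.  This
   value is unique when [Q] is a skew field, and it is the ordinary sum when
   almost all [a n] vanish. *)
Definition rational_sum (Q : unitRingType) (a : nat -> Q) (x : Q) : Prop :=
  exists P S : {poly Q},
    [/\ S.[1] \is a GRing.unit,
        forall n, P`_n = \sum_(k < n.+1) a k * S`_(n - k)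
      & x = P.[1] / S.[1]].

Definition is_transport_matrix ns nt (N : network ns nt) (C : fieldType)
    (Q : unitAlgType C) (s : C) (w : face N -> Q) (M : 'M[Q]_(nt, ns)) : Prop :=
  forall i j, rational_sum (path_sum s w j i) (M i j).

(** * R-matrix *)

Section RMatrix.
Variables (C : fieldType) (q : C) (k : nat).

Definition Rmx : 'M[C]_(k * k) :=
  \sum_(i < k) \sum_(j < k) tensmx (delta_mx i i) (delta_mx j j)
  + (q - 1) *: (\sum_(i < k) tensmx (delta_mx i i) (delta_mx i i))
  + (q - q^-1) *:
      (\sum_(i < k) \sum_(j < k | (j < i)%N) tensmx (delta_mx i j) (delta_mx j i)).

Definition RmxNT : 'M[C]_(k * k) := (invmx Rmx)^T.

End RMatrix.

(** * Relations in tensor notation *)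

Section Relations.
Variables (C : fieldType) (Q : unitAlgType C).

Definition scalar_entries (k l : nat) (A : 'M[C]_(k, l)) : 'M[Q]_(k, l) :=
  map_mx (in_alg Q) A.

Variables (k l : nat).
Implicit Types X Y : 'M[Q]_(k, l).

(* X acting in the first factor, Y in the second: the product X Y ... *)
Definition prod12 X Y : 'M[Q]_(k * k, l * l) :=
  tensmx X (1%:M : 'M_k) *m tensmx (1%:M : 'M_l) Y.
(* ... and the product Y X. *)
Definition prod21 Y X : 'M[Q]_(k * k, l * l) :=
  tensmx (1%:M : 'M_k) Y *m tensmx X (1%:M : 'M_l).

Definition exchange (A : 'M[C]_(k * k)) (B : 'M[C]_(l * l)) X Y : Prop :=
  scalar_entries A *m prod12 X Y = prod21 Y X *m scalar_entries B.

(* Formal series are given by their coefficients: [F a b] is the coefficient of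
   u^a v^b. *)
Definition mulu k' l' (F : int -> int -> 'M[Q]_(k', l')) :=
  fun a b : int => F (a - 1) b.
Definition mulv k' l' (F : int -> int -> 'M[Q]_(k', l')) :=
  fun a b : int => F a (b - 1).

(* Left and right multiplication by R(u,v) = u R^(-T) - v R. *)
Definition mulRl (q : C) (F : int -> int -> 'M[Q]_(k * k, l * l)) :=
  fun a b : int =>
    mulu (fun a b => scalar_entries (RmxNT q k) *m F a b) a b
    - mulv (fun a b => scalar_entries (Rmx q k) *m F a b) a b.
Definition mulRr (q : C) (F : int -> int -> 'M[Q]_(k * k, l * l)) :=
  fun a b : int =>
    mulu (fun a b => F a b *m scalar_entries (RmxNT q l)) a b
    - mulv (fun a b => F a b *m scalar_entries (Rmx q l)) a b.

(* R(u,v) X(u) Y(v) = Y(v) X(u) R(u,v), with X in the first factor and Y in the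
   second one. *)
Definition loop_relation (q : C) (X Y : int -> 'M[Q]_(k, l)) : Prop :=
  forall a b : int,
    mulRl q (fun a b => prod12 (X a) (Y b)) a b
    = mulRr q (fun a b => prod21 (Y b) (X a)) a b.

End Relations.

Section LoopElements.
Variables (Q : unitRingType) (n1 m n2 : nat).
Variables (M11 : 'M[Q]_(m, n1)) (M12 : 'M[Q]_m).
Variables (M21 : 'M[Q]_(n2, n1)) (M22 : 'M[Q]_(n2, m)).

Definition Tplus (k : nat) : 'M[Q]_(n2, n1) :=
  if k is k'.+1 then M22 *m M12 ^+ k' *m M11 else M21.

(* [M12i] is the inverse of [M12]; meant for 1 <= k. *)
Definition Tminus (M12i : 'M[Q]_m) (k : nat) : 'M[Q]_(n2, n1) :=
  M22 *m M12i ^+ k *m M11 - M21 *+ (k == 1%N).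

(* T^+(u) = sum_(k >= 0) T^+_k u^(-k) *)
Definition Tplus_series (z : int) : 'M[Q]_(n2, n1) :=
  match z with
  | Posz 0 => Tplus 0
  | Posz _.+1 => 0
  | Negz k => Tplus k.+1
  end.

(* T^-(u) = sum_(k >= 1) T^-_k u^k *)
Definition Tminus_series (M12i : 'M[Q]_m) (z : int) : 'M[Q]_(n2, n1) :=
  if z is Posz k.+1 then Tminus M12i k.+1 else 0.

End LoopElements.

(* Main.v *)
Require Import Defs.
From mathcomp Require Import all_boot all_order all_algebra.
From mathcomp Require Import reals complex.
From mathcomp Require Import zify mxtens.
Import Order.TTheory GRing.Theory Num.Theory.
Set Implicit Arguments.
Unset Strict Implicit.
Unset Printing Implicit Defensive.
Local Open Scope ring_scope.

(* Write the blocks of the transport matrix as a = M11, A = M12, c = M21,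
   d = M22.  Both T^+(u) and -u^-1 T^-(u) are expansions of the same rational
   expression T(u) = c + d (u - A)^-1 a, at u = oo and at u = 0, so one
   computation with an arbitrary one-sided expansion of (u - A)^-1 proves the
   three loop relations.

   Let P be the flip and B = P R, so that B^2 = 1 + (q - q^-1) B and
   P R^-T = B^-1.  The relations take the form
     (u B^-1 - v B) (T(u) (x) T(v)) = (T(v) (x) T(u)) (u B^-1 - v B),
   where (x) keeps the order of the noncommuting entries.  The block relations
   give, with X = (A (x) 1) P,
     d (u-A)^-1 a (x) d (v-A)^-1 a
       = (d (x) d) (u - X B)^-1 (v - B X)^-1 (a (x) a)
         + (q - q^-1) B^-1 (c (x) d (u-A)^-1 A (v-A)^-1 a).
   As X^2 = A (x) A commutes with B, the first term satisfies the relation by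
   itself; the contribution of the second one cancels those of the products of c
   with d (u-A)^-1 a. *)

(** * One-sided formal expansions of resolvents and their uniqueness *)

Section Resolvents.
Variable R : pzRingType.
Implicit Types (s : bool) (z : int).

(** Series in [u^-1] up to a finite shift when [s] holds, in [u] otherwise: the bound is on the side
    where the coefficients vanish. *)
Definition one_sided s m n (x : int -> 'M[R]_(m, n)) : Prop :=
  exists N : int, forall z, (if s then N <= z else z <= N) -> x z = 0.

(* [g] gives the coefficients of [(u - A)^-1], expanded at [u = oo] if [s] holds
   and at [u = 0] otherwise. *)
Record resolvent s n (A : 'M[R]_n) (g : int -> 'M[R]_n) : Prop := Resolvent {
  resolventl : forall z, g (z - 1) = A *m g z + (z == 0)%:R%:M;
  resolventr : forall z, g (z - 1) = g z *m A + (z == 0)%:R%:M;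
  resolvent_one_sided : one_sided s g;
  resolvent_inv : s \/ exists B : 'M[R]_n, B *m A = 1%:M /\ A *m B = 1%:M
}.

Lemma one_sidedB s m n (x y : int -> 'M[R]_(m, n)) :
  one_sided s x -> one_sided s y -> one_sided s (fun z => x z - y z).
Proof.
move=> [N hN] [N' hN']; exists (if s then Num.max N N' else Num.min N N') => z.
case: s hN hN' => /= hN hN'; rewrite ?ge_max ?le_min => /andP[h h'];
  by rewrite hN // hN' // subr0.
Qed.

Lemma one_sidedD s m n (x y : int -> 'M[R]_(m, n)) :
  one_sided s x -> one_sided s y -> one_sided s (fun z => x z + y z).
Proof.
move=> hx [N hN]; have := one_sidedB hx (y := fun z => - y z) _.
case=> [|M hM]; first by exists N => z /hN->; rewrite oppr0.
by exists M => z /hM; rewrite opprK.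
Qed.

Lemma one_sidedMl s m n p (B : 'M[R]_(p, m)) (x : int -> 'M[R]_(m, n)) :
  one_sided s x -> one_sided s (fun z => B *m x z).
Proof. by move=> [N hN]; exists N => z /hN->; rewrite mulmx0. Qed.

Lemma one_sidedMr s m n p (B : 'M[R]_(n, p)) (x : int -> 'M[R]_(m, n)) :
  one_sided s x -> one_sided s (fun z => x z *m B).
Proof. by move=> [N hN]; exists N => z /hN->; rewrite mul0mx. Qed.

Lemma one_sided_shift s m n (x : int -> 'M[R]_(m, n)) :
  one_sided s x -> one_sided s (fun z => x (z - 1)).
Proof.
by move=> [N hN]; exists (if s then N + 1 else N) => z hz; apply: hN; case: s hz; lia.
Qed.

(** Uniqueness principle behind the resolvent identities. The homogeneous recursion carries the
    vanishing downwards by itself when [s] holds, and upwards after multiplication by the inverse of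
    [A] otherwise. *)
Lemma one_sided_eq0 s m n (A : 'M[R]_m) g (x : int -> 'M[R]_(m, n)) :
  resolvent s A g -> one_sided s x -> (forall z, x (z - 1) = A *m x z) ->
  forall z, x z = 0.
Proof.
move=> hg [N hN] hx z; case: s hg hN => [_|] /=.
- move=> hN; have [/hN//|ltzN] := leP N z.
  have -> : z = N - `|N - z|%N%:Z by lia.
  move: `|N - z|%N => k; elim: k => [|k IH]; first by rewrite subr0 hN.
  have -> : N - k.+1%:Z = N - k%:Z - 1 by lia.
  by rewrite hx IH mulmx0.
- case=> _ _ _ [//|[B [BA AB]]] hN; have [/hN//|ltNz] := leP z N.
  have -> : z = N + `|z - N|%N%:Z by lia.
  move: `|z - N|%N => k; elim: k => [|k IH]; first by rewrite addr0 hN.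
  rewrite -[LHS]mul1mx -BA -mulmxA -hx.
  have -> : N + k.+1%:Z - 1 = N + k%:Z by lia.
  by rewrite IH mulmx0.
Qed.

Lemma mulmx_nat_scalar m n k (X : 'M[R]_(m, n)) :
  X *m k%:R%:M = k%:R%:M *m X.
Proof.
elim: k => [|k IH]; first by rewrite mulr0n !raddf0 mul0mx.
by rewrite -natr1 !raddfD /= mulmxDl IH mulmx1 mul1mx.
Qed.

(** The delta terms of the two recursions cancel in [g z *m X - X *m h z], which is one-sided and
    solves the homogeneous recursion. *)
Lemma resolvent_intertwine s m n (A : 'M[R]_m) (B : 'M[R]_n) g h
    (X : 'M[R]_(m, n)) :
  resolvent s A g -> resolvent s B h -> A *m X = X *m B ->
  forall z, g z *m X = X *m h z.
Proof.
move=> hg hh AX z; apply/eqP; rewrite -subr_eq0; apply/eqP.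
have hs : one_sided s (fun z => g z *m X - X *m h z).
  by apply: one_sidedB; [apply: one_sidedMr; case: hg | apply: one_sidedMl; case: hh].
move: z; apply: (one_sided_eq0 hg hs) => z.
rewrite (resolventl hg) (resolventl hh) mulmxDl mulmxDr mulmxBr !mulmxA AX.
by rewrite mulmx_nat_scalar opprD addrACA subrr addr0.
Qed.

Lemma resolvent_comm s n (A : 'M[R]_n) g X :
  resolvent s A g -> A *m X = X *m A -> forall z, g z *m X = X *m g z.
Proof. by move=> hg; apply: (resolvent_intertwine hg hg). Qed.

(* Coefficients of the expansions of [(u - A)^-1] at [u = oo] and, if [B] is
   the inverse of [A], at [u = 0]. *)
Definition resp n (A : 'M[R]_n) z : 'M[R]_n := if z is Negz k then A ^+ k else 0.
Definition resm n (B : 'M[R]_n) z : 'M[R]_n := if z is Posz k then - B ^+ k.+1 else 0.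

Lemma respP n (A : 'M[R]_n) : resolvent true A (resp A).
Proof.
have com k : A *m A ^+ k = A ^+ k *m A by have := commrX k (erefl (A * A)).
have rec z : resp A (z - 1) = A *m resp A z + (z == 0)%:R%:M.
  case: z => [[|k]|k].
  - by rewrite sub0r /= mulmx0 add0r.
  - by rewrite (_ : k.+1%:Z - 1 = k) ?mulmx0 ?raddf0 ?addr0 //; lia.
  - by rewrite (_ : Negz k - 1 = Negz k.+1) ?raddf0 ?addr0 /= ?exprS //; lia.
split=> //; last by left.
- by move=> z; rewrite rec; case: z => k; rewrite //= ?mulmx0 ?mul0mx ?com.
- by exists 0; case.
Qed.

Lemma resmP n (A B : 'M[R]_n) : B *m A = 1%:M -> A *m B = 1%:M ->
  resolvent false A (resm B).
Proof.
move=> BA AB; split; last by right; exists B.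
- case=> [[|k]|k].
  + by rewrite sub0r /= mulmxN expr1 AB addNr.
  + rewrite (_ : k.+1%:Z - 1 = k) ?raddf0 ?addr0 /=; last by lia.
    by rewrite mulmxN [B ^+ k.+2]exprS -[_ * _]/(B *m _) mulmxA AB mul1mx.
  + by rewrite (_ : Negz k - 1 = Negz k.+1) ?raddf0 ?addr0 /= ?mulmx0 //; lia.
- case=> [[|k]|k].
  + by rewrite sub0r /= mulNmx expr1 BA addNr.
  + rewrite (_ : k.+1%:Z - 1 = k) ?raddf0 ?addr0 /=; last by lia.
    by rewrite mulNmx [B ^+ k.+2]exprSr -[_ * B]/(_ *m B) -mulmxA BA mulmx1.
  + by rewrite (_ : Negz k - 1 = Negz k.+1) ?raddf0 ?addr0 /= ?mul0mx //; lia.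
- by exists (-1); case=> // k; lia.
Qed.

Lemma resolvent_ex s n (A : 'M[R]_n) :
  s \/ (exists B : 'M[R]_n, B *m A = 1%:M /\ A *m B = 1%:M) ->
  exists g, resolvent s A g.
Proof.
case: s => [_|[//|[B [BA AB]]]]; first by exists (resp A); apply: respP.
by exists (resm B); apply: resmP.
Qed.

(* [(p0 + v p1) (v - B)^-1 = (v - A)^-1 (r0 + v r1)] follows by clearing the
   denominators. *)
Lemma resolvent_linear s m n (A : 'M[R]_m) (B : 'M[R]_n) g h
    (p0 p1 r0 : 'M[R]_(m, n)) :
  resolvent s A g -> resolvent s B h ->
  A *m p0 = r0 *m B -> p0 - A *m p1 = r0 - p1 *m B ->
  forall z, p0 *m h z + p1 *m h (z - 1) = g z *m r0 + g (z - 1) *m p1.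
Proof.
move=> hg hh Ap0 Ap1 z; apply/eqP; rewrite -subr_eq0; apply/eqP.
have [sg sh] := (resolvent_one_sided hg, resolvent_one_sided hh).
pose x z := p0 *m h z + p1 *m h (z - 1) - (g z *m r0 + g (z - 1) *m p1).
have hs : one_sided s x.
  by apply: one_sidedB; apply: one_sidedD;
    do ?[apply: one_sidedMl | apply: one_sidedMr]; try exact: one_sided_shift.
rewrite -/(x z).
move: z; apply: (one_sided_eq0 hg hs) => z; rewrite /x mulmxBr.
(* Both sides obey the same recursion with inhomogeneous term [D], so their difference [x] solves
   the homogeneous one. *)
pose D := (z == 0)%:R%:M *m r0 + (z - 1 == 0)%:R%:M *m p1.
have -> : p0 *m h (z - 1) + p1 *m h (z - 1 - 1)
          = A *m (p0 *m h z + p1 *m h (z - 1)) + D.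
  rewrite (resolventl hh (z - 1)) mulmxDr mulmx_nat_scalar mulmxA.
  have {1}-> : p0 = r0 + A *m p1 - p1 *m B by rewrite addrAC -Ap1 subrK.
  rewrite mulmxBl addrA subrK mulmxDl {1}(resolventl hh z).
  by rewrite !mulmxDr !mulmxA Ap0 mulmx_nat_scalar /D addrA [_ + _ + A *m _ *m _]addrAC.
have -> : g (z - 1) *m r0 + g (z - 1 - 1) *m p1
          = A *m (g z *m r0 + g (z - 1) *m p1) + D.
  by rewrite (resolventl hg (z - 1)) {1}(resolventl hg z) !mulmxDl mulmxDr !mulmxA addrACA.
by rewrite opprD addrACA subrr addr0.
Qed.
End Resolvents.

(** * Tensor products over a noncommutative ring, and the flip *)

Lemma tens_matrixP (R : Type) m n p q (X Y : 'M[R]_(m * n, p * q)) :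
  (forall i k j l, X (mxtens_index (i, k)) (mxtens_index (j, l))
                   = Y (mxtens_index (i, k)) (mxtens_index (j, l))) -> X = Y.
Proof.
move=> eqXY; apply/matrixP => a b.
case: (mxtens_indexP a) => i k; case: (mxtens_indexP b) => j l.
exact: eqXY.
Qed.

Section TensorProducts.
Variable R : pzRingType.

Lemma sum_tens_index n q (F : 'I_(n * q) -> R) :
  \sum_a F a = \sum_i \sum_j F (mxtens_index (i, j)).
Proof.
rewrite pair_bigA (reindex (@mxtens_index n q)) /=; last first.
  by exists (@mxtens_unindex n q) => ? _; rewrite ?mxtens_indexK ?mxtens_unindexK.
by apply: eq_bigr => -[].
Qed.

(** The flip [P], rectangular in form since it must also exchange factors of different dimensions,
    such as blocks of different sizes. *)
Definition tens_swap k l : 'M[R]_(k * l, l * k) :=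
  \matrix_(i, j)
    (j == mxtens_index ((mxtens_unindex i).2, (mxtens_unindex i).1))%:R.

Lemma mul_tens_swap k l p (Z : 'M[R]_(l * k, p)) i j c :
  (tens_swap k l *m Z) (mxtens_index (i, j)) c = Z (mxtens_index (j, i)) c.
Proof.
rewrite mxE (bigD1 (mxtens_index (j, i))) //= big1 => [|b ne_b].
  by rewrite mxE mxtens_indexK /= eqxx mul1r addr0.
by rewrite mxE mxtens_indexK /= (negbTE ne_b) mul0r.
Qed.

Lemma tr_tens_swap k l : (tens_swap k l)^T = tens_swap l k.
Proof.
apply: tens_matrixP => i j i' j'; rewrite !mxE !mxtens_indexK /=.
by congr (nat_of_bool _)%:R; apply/eqP/eqP => /(can_inj (@mxtens_indexK _ _)) [-> ->].
Qed.

Lemma mul_mx_tens_swap k l p (Z : 'M[R]_(p, k * l)) r i j :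
  (Z *m tens_swap k l) r (mxtens_index (i, j)) = Z r (mxtens_index (j, i)).
Proof.
rewrite mxE (bigD1 (mxtens_index (j, i))) //= big1 => [|b ne_b].
  by rewrite -tr_tens_swap !mxE mxtens_indexK /= eqxx mulr1 addr0.
by rewrite -tr_tens_swap !mxE mxtens_indexK /= (negbTE ne_b) mulr0.
Qed.

Lemma tens_swapK k l : tens_swap k l *m tens_swap l k = 1%:M.
Proof.
apply: tens_matrixP => i j i' j'; rewrite mul_tens_swap !mxE !mxtens_indexK /=.
by rewrite eq_sym.
Qed.

Lemma tens_swapKl k l p (Z : 'M[R]_(k * l, p)) :
  tens_swap k l *m (tens_swap l k *m Z) = Z.
Proof. by rewrite mulmxA tens_swapK mul1mx. Qed.

Lemma tens_swapKr k l p (Z : 'M[R]_(p, k * l)) :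
  Z *m tens_swap k l *m tens_swap l k = Z.
Proof. by rewrite -mulmxA tens_swapK mulmx1. Qed.

(** The general mixed product rule fails for noncommuting entries. It survives here because the
    inserted identity leaves the entries in the order [X], [X'], [Y]. *)
Lemma tens_mxMl m n p q r (X : 'M[R]_(m, n)) (X' : 'M[R]_(n, p)) (Y : 'M[R]_(q, r)) :
  (X *m X') *t Y = (X *t 1%:M) *m (X' *t Y).
Proof.
apply: tens_matrixP => i k j l; rewrite tensmxE !mxE big_distrl sum_tens_index /=.
apply: eq_bigr => s _; rewrite (bigD1 k) //= big1 => [|t ne_t].
  by rewrite !tensmxE mxE eqxx mulr1 addr0 mulrA.
by rewrite !tensmxE mxE eq_sym (negbTE ne_t) mulr0 mul0r.
Qed.

Lemma tens_mxMr m n p q r (X : 'M[R]_(m, n)) (Y : 'M[R]_(p, q)) (Y' : 'M[R]_(q, r)) :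
  X *t (Y *m Y') = (X *t Y) *m (1%:M *t Y').
Proof.
apply: tens_matrixP => i k j l; rewrite tensmxE !mxE big_distrr sum_tens_index exchange_big /=.
apply: eq_bigr => t _; rewrite (bigD1 j) //= big1 => [|s ne_s].
  by rewrite !tensmxE mxE eqxx mul1r addr0 mulrA.
by rewrite !tensmxE mxE (negbTE ne_s) mul0r mulr0.
Qed.

Lemma tens_mx_decr m n p q (X : 'M[R]_(m, n)) (Y : 'M[R]_(p, q)) :
  (X *t 1%:M) *m (1%:M *t Y) = X *t Y.
Proof. by rewrite -tens_mxMl mulmx1. Qed.

(** With an identity as the other factor, moving the flip across reverses no product of entries. *)
Lemma tens_swapMl m n k (X : 'M[R]_(m, n)) :
  tens_swap k m *m (X *t 1%:M) = (1%:M *t X) *m tens_swap k n.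
Proof.
by apply: tens_matrixP => i j i' j';
  rewrite mul_tens_swap mul_mx_tens_swap !tensmxE; 
  rewrite !mxE; case: eqP; rewrite ?(mulr1, mul1r, mulr0, mul0r).
Qed.

Lemma tens_swapMr m n k (X : 'M[R]_(m, n)) :
  tens_swap m k *m (1%:M *t X) = (X *t 1%:M) *m tens_swap n k.
Proof. by rewrite -[LHS]tens_swapKr -(mulmxA (tens_swap _ _)) -tens_swapMl tens_swapKl. Qed.

Lemma tens_mx1 k l : (1%:M : 'M[R]_k) *t (1%:M : 'M[R]_l) = 1%:M.
Proof.
apply: tens_matrixP => i j i' j'; rewrite tensmxE !mxE -natrM mulnb.
rewrite (inj_eq (can_inj (@mxtens_indexK _ _))) //.
Qed.

Lemma tens_mxDl m n p q (X X' : 'M[R]_(m, n)) (Y : 'M[R]_(p, q)) :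
  (X + X') *t Y = X *t Y + X' *t Y.
Proof. by apply/matrixP => i j; rewrite !mxE mulrDl. Qed.

Lemma tens_mxDr m n p q (X : 'M[R]_(m, n)) (Y Y' : 'M[R]_(p, q)) :
  X *t (Y + Y') = X *t Y + X *t Y'.
Proof. by apply/matrixP => i j; rewrite !mxE mulrDr. Qed.

Lemma tens_mxNl m n p q (X : 'M[R]_(m, n)) (Y : 'M[R]_(p, q)) : (- X) *t Y = - (X *t Y).
Proof. by apply/matrixP => i j; rewrite !mxE mulNr. Qed.

Lemma tens_mxNr m n p q (X : 'M[R]_(m, n)) (Y : 'M[R]_(p, q)) : X *t (- Y) = - (X *t Y).
Proof. by apply/matrixP => i j; rewrite !mxE mulrN. Qed.

Lemma resolvent_tensl s n k (A : 'M[R]_n) g :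
  resolvent s A g ->
  resolvent s (A *t (1%:M : 'M[R]_k)) (fun z => g z *t (1%:M : 'M[R]_k)).
Proof.
have D (b : bool) : (b%:R%:M : 'M[R]_n) *t (1%:M : 'M[R]_k) = b%:R%:M.
  by case: b; rewrite ?tens_mx1 //; apply/matrixP => i j; rewrite !mxE !mul0rn ?mul0r ?mulr0.
case=> gl gr [N gN] gi; split.
- by move=> z; rewrite gl tens_mxDl tens_mxMl D.
- by move=> z; rewrite gr tens_mxDl tens_mxMl D.
- by exists N => z /gN ->; rewrite tens0mx.
- case: gi => [|[B [BA AB]]]; [by left | right].
  by exists (B *t 1%:M); rewrite -!tens_mxMl BA AB tens_mx1.
Qed.

Lemma resolvent_tensr s n k (A : 'M[R]_n) g :
  resolvent s A g ->
  resolvent s ((1%:M : 'M[R]_k) *t A) (fun z => (1%:M : 'M[R]_k) *t g z).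
Proof.
have D (b : bool) : (1%:M : 'M[R]_k) *t (b%:R%:M : 'M[R]_n) = b%:R%:M.
  by case: b; rewrite ?tens_mx1 //; apply/matrixP => i j; rewrite !mxE !mul0rn ?mul0r ?mulr0.
case=> gl gr [N gN] gi; split.
- by move=> z; rewrite gl tens_mxDr tens_mxMr D.
- by move=> z; rewrite gr tens_mxDr tens_mxMr D.
- by exists N => z /gN ->; rewrite tensmx0.
- case: gi => [|[B [BA AB]]]; [by left | right].
  by exists (1%:M *t B); rewrite -!tens_mxMr BA AB tens_mx1.
Qed.

End TensorProducts.

(** * Central scalars and the Hecke relation *)

Section Central.
Variable R : pzRingType.

Definition central (x : R) : Prop := forall y, x * y = y * x.

Lemma central_nat k : central k%:R.
Proof. by move=> y; rewrite mulr_natl mulr_natr. Qed.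

Variables (x : R) (cx : central x).

Lemma central_scalemxr m n p (X : 'M[R]_(m, n)) (Y : 'M[R]_(n, p)) :
  X *m (x *: Y) = x *: (X *m Y).
Proof.
apply/matrixP => i j; rewrite !mxE big_distrr; apply: eq_bigr => k _ /=.
by rewrite mxE !mulrA cx.
Qed.

Lemma central_mul_mx_scalar m n (X : 'M[R]_(m, n)) : X *m x%:M = x *: X.
Proof. by rewrite -scalemx1 central_scalemxr mulmx1. Qed.

Lemma central_tens_scaler m n p q (X : 'M[R]_(m, n)) (Y : 'M[R]_(p, q)) :
  X *t (x *: Y) = x *: (X *t Y).
Proof. by apply/matrixP => i j; rewrite !mxE !mulrA cx. Qed.

End Central.

Lemma tens_scalel (R : pzRingType) (x : R) m n p q
    (X : 'M[R]_(m, n)) (Y : 'M[R]_(p, q)) :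
  (x *: X) *t Y = x *: (X *t Y).
Proof. by apply/matrixP => i j; rewrite !mxE mulrA. Qed.

(** For [lam = q - q^-1] this is the quadratic relation [(H - q)(H + q^-1) = 0], written as
    [H - H^-1 = lam] with the inverse kept explicit. *)
Record hecke (R : pzRingType) (lam : R) n (H Hi : 'M[R]_n) : Prop := Hecke {
  heckeV : H *m Hi = 1%:M;
  heckeVl : Hi *m H = 1%:M;
  heckeE : H = Hi + lam%:M
}.

Section HeckeAlgebra.
Variables (R : pzRingType) (lam : R) (clam : central lam).

Section Square.
Variables (n : nat) (H Hi X : 'M[R]_n).
Hypotheses (hH : hecke lam H Hi) (HXX : H *m (X *m X) = X *m X *m H).

(* An identity in the affine Hecke algebra of GL_2, whose commuting generators are
   [H X] and [X Hi]. *)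
Lemma hecke_resolvent s s' G N L K :
  resolvent s (X *m H) G -> resolvent s (H *m X) N ->
  resolvent s' (X *m H) L -> resolvent s' (H *m X) K ->
  forall a b, Hi *m (G (a - 1) *m K b) - H *m (G a *m K (b - 1))
              = L b *m N (a - 1) *m Hi - L (b - 1) *m N a *m H.
Proof.
case: hH => V Vl E hG hN hL hK a b.
(* Both [X] (by [HXX]) and [H] intertwine [X H] with [H X], hence [G] with [N]. *)
have XG z : X *m G z = N z *m X.
  by rewrite (resolvent_intertwine hN hG) // -[H *m X *m X]mulmxA HXX mulmxA.
have HG z : H *m G z = N z *m H.
  by rewrite (resolvent_intertwine hN hG) // mulmxA.
have Ei : Hi = H - lam%:M by rewrite E addrK.
have HH : H *m H = 1%:M + lam *: H.
  by rewrite {2}E mulmxDr V central_mul_mx_scalar.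
(* For a fixed exponent [a] the claim is an instance of [resolvent_linear] in [v], with
   [p0 = Hi G (a - 1)], [p1 = - H G a] and [r0 = N (a - 1) Hi]. Its two hypotheses are [e0] and
   [e1]. *)
have e0 : X *m H *m (Hi *m G (a - 1)) = N (a - 1) *m Hi *m (H *m X).
  by rewrite -!mulmxA (mulmxA H) V mul1mx XG (mulmxA Hi) Vl mul1mx.
have e1 : Hi *m G (a - 1) - X *m H *m (- (H *m G a))
        = N (a - 1) *m Hi - (- (H *m G a)) *m (H *m X).
  rewrite mulmxN mulNmx !opprK (resolventl hG) (resolventr hN) mulmxDr mulmxDl.
  rewrite mulmx_nat_scalar addrAC [RHS]addrAC; congr (_ + _).
  rewrite !mulmxA -mulmxDl HG -!mulmxA -mulmxDr.
  (* By the Hecke relation the [lam] terms cancel, and this sum and the next one reduce to the same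
     [X + H X H]. *)
  have -> : Hi *m (X *m H) + X *m (H *m H) = X + H *m X *m H.
    rewrite HH Ei mulmxBl mulmxDr mulmx1 mul_scalar_mx (central_scalemxr clam).
    by rewrite addrCA subrK mulmxA.
  have -> : H *m (X *m Hi) + H *m (H *m X) = X + H *m X *m H.
    rewrite (mulmxA H H) HH Ei mulmxBr mulmxDl mul1mx (central_mul_mx_scalar clam).
    by rewrite mulmxBr (central_scalemxr clam) -scalemxAl addrCA subrK mulmxA.
  rewrite mulmxDl mulmxDr XG; congr (_ + _).
  by rewrite -mulmxA HG mulmxA -(resolvent_comm hN) ?mulmxA.
have := resolvent_linear hL hK e0 e1 b.
by rewrite HG !mulNmx !mulmxN !mulmxA HG.
Qed.

End Square.

Section Cross.
Variables (k l : nat) (H Hi : 'M[R]_k) (J Ji : 'M[R]_l).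
Hypotheses (hH : hecke lam H Hi) (hJ : hecke lam J Ji).
Variable S : 'M[R]_(k, l).

Lemma hecke_sqr n (G Gi : 'M[R]_n) :
  hecke lam G Gi -> G *m G = 1%:M + lam *: G /\ Gi *m Gi = 1%:M - lam *: Gi.
Proof.
case=> V Vl E; split; first by rewrite {2}E mulmxDr V central_mul_mx_scalar.
have {2}-> : Gi = G - lam%:M by rewrite E addrK.
by rewrite mulmxBr Vl central_mul_mx_scalar.
Qed.

(** This and the next two identities reduce all the terms left over in the exchange relation to the
    single shape [S - Hi S J]. *)
Lemma hecke_inv_cross : Hi *m Hi *m S - Hi *m S *m Ji = S - Hi *m S *m J.
Proof.
have [_ ->] := hecke_sqr hH; have -> : Ji = J - lam%:M by rewrite (heckeE hJ) addrK.
by rewrite mulmxBl mulmxBr mul1mx central_mul_mx_scalar // -!scalemxAl opprB addrA subrK.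
Qed.

Lemma hecke_crossl : Hi *m Hi *m S *m J - S *m Ji = lam *: (S - Hi *m S *m J).
Proof.
have [_ ->] := hecke_sqr hH; have -> : Ji = J - lam%:M by rewrite (heckeE hJ) addrK.
rewrite 2!mulmxBl mulmxBr mul1mx central_mul_mx_scalar // opprB -!scalemxAl.
by rewrite scalerBr addrC addrA subrK.
Qed.

Lemma hecke_crossr : H *m S - Hi *m S *m J *m J = lam *: (S - Hi *m S *m J).
Proof.
have [e _] := hecke_sqr hJ; rewrite -[_ *m J *m J]mulmxA e (heckeE hH).
rewrite mulmxDl mul_scalar_mx mulmxDr mulmx1 central_scalemxr // scalerBr.
by rewrite opprD addrACA subrr add0r.
Qed.
End Cross.
End HeckeAlgebra.

(** * From the block relations to the exchange relation for [c + d (u - A)^-1 a] *)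

Section BlockRelations.
Variables (R : pzRingType) (lam : R) (clam : central lam) (m n1 n2 : nat).
Variables (Rm Rmi : 'M[R]_(m * m)) (Rk Rki : 'M[R]_(n2 * n2)).
Variables (Rj Rji : 'M[R]_(n1 * n1)).
Hypotheses (hm : hecke lam Rm Rmi) (hk : hecke lam Rk Rki) (hj : hecke lam Rj Rji).
Variables (A : 'M[R]_m) (a : 'M[R]_(m, n1)) (c : 'M[R]_(n2, n1)) (d : 'M[R]_(n2, m)).

Local Notation P k l := (tens_swap R k l).

(** Components of [B (M (x) M) = (M (x) M) B]. A pair of indices from one block range keeps its
    Hecke matrix, a mixed pair leaves only the flip, and [rad] alone has a [lam] correction. *)
Hypothesis rAA : Rm *m (A *t A) = A *t A *m Rm.
Hypothesis rAd : P n2 m *m (A *t d) = d *t A *m Rm.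
Hypothesis rAa : Rm *m (A *t a) = a *t A *m P n1 m.
Hypothesis rAc : P n2 m *m (A *t c) = c *t A *m P n1 m.
Hypothesis rad : P n2 m *m (a *t d) = d *t a *m P m n1 + lam *: (c *t A).
Hypothesis rac : P n2 m *m (a *t c) = c *t a *m Rj.
Hypothesis rdc : Rk *m (d *t c) = c *t d *m P n1 m.
Hypothesis rdd : Rk *m (d *t d) = d *t d *m Rm.
Hypothesis raa : Rm *m (a *t a) = a *t a *m Rj.
Hypothesis rcc : Rk *m (c *t c) = c *t c *m Rj.

(** Lets a relation with [R] be traded for the one with [R^-T], which in braided form is the inverse
    Hecke matrix. *)
Lemma hecke_conj n p (H Hi : 'M[R]_n) (J Ji : 'M[R]_p) (X : 'M[R]_(n, p)) :
  hecke lam H Hi -> hecke lam J Ji -> H *m X = X *m J -> Hi *m X = X *m Ji.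
Proof.
move=> hH hJ HX; rewrite -[RHS]mul1mx -(heckeVl hH) -!mulmxA (mulmxA H) HX.
by rewrite -mulmxA (heckeV hJ) mulmx1.
Qed.

Lemma tens_swap_dc p (Y : 'M[R]_(m, p)) :
  (d *t 1%:M) *m (P m n2 *m (c *t Y)) = Rki *m (c *t (d *m Y)).
Proof.
rewrite -[c *t Y]tens_mx_decr (mulmxA (P m n2)) tens_swapMl.
rewrite !mulmxA tens_mx_decr.
have -> : d *t c = Rki *m (c *t d) *m P n1 m by rewrite -mulmxA -rdc mulmxA (heckeVl hk) mul1mx.
by rewrite tens_swapKr tens_mxMr -mulmxA.
Qed.

(** By [rAc] the entries of [A] commute with those of [c], hence so do those of the resolvent. *)
Lemma resolvent_c s g : resolvent s A g -> forall z p (Y : 'M[R]_(m, p)),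
  (1%:M *t g z) *m (c *t Y) = c *t (g z *m Y).
Proof.
move=> hg z p Y; rewrite -[c *t Y]tens_mx_decr mulmxA.
rewrite (resolvent_intertwine (resolvent_tensr n2 hg) (resolvent_tensr n1 hg)).
  by rewrite -mulmxA -tens_mxMr tens_mx_decr.
rewrite tens_mx_decr -[RHS]tens_swapKr -rAc -(tens_mx_decr A c) mulmxA tens_swapMl.
by rewrite -!mulmxA (mulmxA (P _ _)) tens_swapMr -mulmxA tens_swapK mulmx1.
Qed.

(** Moving [c] to the left past [a], the resolvent and [d] produces [Rj] from [rac], nothing, and
    [Rki] from [rdc]. *)
Lemma T0_c s g : resolvent s A g -> forall z,
  (d *m g z *m a) *t c = Rki *m (c *t (d *m g z *m a)) *m Rj.
Proof.
move=> hg z; rewrite tens_mxMl tens_mxMl -mulmxA.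
have -> : a *t c = P m n2 *m ((c *t a) *m Rj) by rewrite -rac tens_swapKl.
rewrite (mulmxA _ (P m n2)) -tens_swapMr -(mulmxA (P m n2)) (mulmxA _ (c *t a)).
by rewrite (resolvent_c hg) !mulmxA -(mulmxA (d *t _)) tens_swap_dc !mulmxA.
Qed.

(** With [X = (A (x) 1) P], [rAd] says that [1 (x) d] intertwines [A (x) 1] with [X Rm]. *)
Lemma resolvent_d s g G : resolvent s A g ->
  resolvent s (A *t 1%:M *m P m m *m Rm) G -> forall z,
  (g z *t 1%:M) *m (1%:M *t d) = (1%:M *t d) *m G z.
Proof.
move=> hg hG; apply: (resolvent_intertwine (resolvent_tensl n2 hg) hG).
rewrite tens_mx_decr -(tens_swapKl (A *t d)) rAd -[d *t A]tens_mx_decr.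
by rewrite !mulmxA tens_swapMl -!mulmxA (mulmxA (P m m)) tens_swapMr !mulmxA.
Qed.

Lemma resolvent_a s h K : resolvent s A h ->
  resolvent s (Rm *m (A *t 1%:M *m P m m)) K -> forall z,
  (a *t 1%:M) *m (1%:M *t h z) = K z *m (a *t 1%:M).
Proof.
move=> hh hK z; symmetry.
apply: (resolvent_intertwine hK (resolvent_tensr n1 hh)).
rewrite tens_mx_decr -(tens_swapKr (a *t A)) -rAa -[A *t a]tens_mx_decr.
by rewrite -!mulmxA tens_swapMl !mulmxA.
Qed.

(** Only the adjacent [a] and [d] are exchanged. The main term of [rad] moves them outwards and
    turns the resolvents into [G] and [K]; its correction [c (x) A] joins the two resolvents into
    [g A h]. *)
Lemma T0_T0 s s' g h G K :
  resolvent s A g -> resolvent s' A h ->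
  resolvent s (A *t 1%:M *m P m m *m Rm) G ->
  resolvent s' (Rm *m (A *t 1%:M *m P m m)) K ->
  forall x y, (d *m g x *m a) *t (d *m h y *m a)
    = (d *t d) *m (G x *m K y) *m (a *t a)
      + lam *: (Rki *m (c *t (d *m (g x *m A *m h y) *m a))).
Proof.
move=> hg hh hG hK x y.
rewrite tens_mxMl tens_mxMl -!mulmxA !tens_mxMr.
have -> : a *t d = P m n2 *m ((d *t a) *m P m n1 + lam *: (c *t A)).
  by rewrite -rad tens_swapKl.
rewrite mulmxDr !(mulmxDl, mulmxDr); congr (_ + _).
  rewrite -[d *t a]tens_mx_decr -(mulmxA (d *t _)) -[1%:M *t a *m _]tens_swapMl.
  rewrite (mulmxA (P m n2)) [P m n2 *m _]tens_swapMl -!mulmxA (mulmxA (P m m)) tens_swapK mul1mx.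
  rewrite (mulmxA (g x *t _)) (resolvent_d hg hG) (mulmxA (a *t _)) (resolvent_a hh hK).
  by rewrite -!mulmxA tens_mx_decr !mulmxA tens_mx_decr.
rewrite (central_scalemxr clam) -scalemxAl !(central_scalemxr clam); congr (_ *: _).
rewrite -!mulmxA (mulmxA (c *t A)) -[c *t A *m _]tens_mxMr.
rewrite -[c *t (A *m h y) *m _]tens_mxMr (mulmxA (g x *t _)) -tens_swapMr.
rewrite -(mulmxA (P m n2)) (resolvent_c hg) tens_swap_dc.
by rewrite -!tens_mxMr !mulmxA.
Qed.

(* The coefficient of [u^z] in [c + d (u - A)^-1 a]. *)
Definition loop_series (g : int -> 'M[R]_m) (z : int) : 'M[R]_(n2, n1) :=
  (z == 0)%:R *: c + d *m g z *m a.

Let S (X : 'M[R]_m) : 'M[R]_(n2 * n2, n1 * n1) := c *t (d *m X *m a).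

Lemma loop_series_tens s s' g h G K :
  resolvent s A g -> resolvent s' A h ->
  resolvent s (A *t 1%:M *m P m m *m Rm) G ->
  resolvent s' (Rm *m (A *t 1%:M *m P m m)) K ->
  forall x y, loop_series g x *t loop_series h y
    = ((x == 0)%:R * (y == 0)%:R) *: (c *t c) + (x == 0)%:R *: S (h y)
      + (y == 0)%:R *: (Rki *m S (g x) *m Rj)
      + (d *t d) *m (G x *m K y) *m (a *t a)
      + lam *: (Rki *m S (g x *m A *m h y)).
Proof.
move=> hg hh hG hK x y.
rewrite tens_mxDl !tens_mxDr !(central_tens_scaler (@central_nat _ _)) !tens_scalel.
by rewrite scalerA (T0_c hg) (T0_T0 hg hh hG hK) !addrA central_nat.
Qed.

Lemma subr_exchange (V : zmodType) (p q r t : V) : p - r = q - t -> p - q = r - t.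
Proof. by move=> e; rewrite -[p](subrK r) e addrAC [q - t]addrC addrK addrC. Qed.

(** Matches the terms of two expansions [loop_series_tens] with the factors exchanged, hence [y3]
    before [y2], and isolates the fourth, main term. *)
Lemma subr_sum5 (V : zmodType) (x1 x2 x3 x4 x5 y1 y2 y3 y4 y5 : V) :
  (x1 + x2 + x3 + x4 + x5) - (y1 + y3 + y2 + y4 + y5)
  = (x4 - y4) + ((x1 - y1) + (x2 - y2) + (x3 - y3) + (x5 - y5)).
Proof.
have D (u v u' v' : V) : u + v - (u' + v') = (u - u') + (v - v') by rewrite opprD addrACA.
by rewrite (addrAC y1) !D addrAC addrC.
Qed.

Section Cross.
Variables (e f : R) (ce : central e) (cf : central f).
Variables C X Y Z W W' : 'M[R]_(n2 * n2, n1 * n1).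
Let cfe : central (f * e).
Proof. by move=> z; rewrite -mulrA ce mulrA cf mulrA. Qed.
Hypothesis CR : Rk *m C = C *m Rj.

(** The variables stand for the terms of [loop_series_tens], with [e], [f] the deltas and [W], [W']
    the main terms. The [C] and [X] terms cancel, and the Hecke identities merge those with [Y] and
    [Z]; in [cross_dir] the roles of [X] and [Y] are exchanged. *)
Lemma cross_inv :
  Rki *m ((e * f) *: C + e *: X + f *: (Rki *m Y *m Rj) + W + lam *: (Rki *m Z))
  - ((f * e) *: C + f *: Y + e *: (Rki *m X *m Rj) + W' + lam *: (Rki *m Z)) *m Rji
  = (Rki *m W - W' *m Rji)
    + lam *: (f *: Y + Z - Rki *m (f *: Y + Z) *m Rj).
Proof.
rewrite !mulmxDr !mulmxDl subr_sum5 -cf; congr (_ + _).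
rewrite !(central_scalemxr cfe) !(central_scalemxr ce) !(central_scalemxr cf).
rewrite !(central_scalemxr clam) -!scalemxAl -!scalerBr.
rewrite (hecke_conj hk hj CR) !mulmxA -(mulmxA _ Rj) (heckeV hj) mulmx1 !subrr !scaler0.
rewrite !add0r (hecke_crossl clam hk hj) (hecke_inv_cross clam hk hj).
by rewrite scalerA cf -scalerA -scalerDr scalerBr opprD addrACA.
Qed.

Lemma cross_dir :
  Rk *m ((e * f) *: C + e *: X + f *: (Rki *m Y *m Rj) + W + lam *: (Rki *m Z))
  - ((f * e) *: C + f *: Y + e *: (Rki *m X *m Rj) + W' + lam *: (Rki *m Z)) *m Rj
  = (Rk *m W - W' *m Rj)
    + lam *: (e *: X + Z - Rki *m (e *: X + Z) *m Rj).
Proof.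
rewrite !mulmxDr !mulmxDl subr_sum5 -cf; congr (_ + _).
rewrite !(central_scalemxr cfe) !(central_scalemxr ce) !(central_scalemxr cf).
rewrite !(central_scalemxr clam) -!scalemxAl -!scalerBr.
rewrite CR !mulmxA (heckeV hk) !mul1mx !subrr !scaler0.
rewrite add0r addr0 (hecke_crossr clam hk hj).
by rewrite scalerA ce -scalerA -scalerDr scalerBr opprD addrACA.
Qed.
End Cross.

Lemma loop_exchange s s' g h :
  resolvent s A g -> resolvent s' A h -> forall x y,
  Rki *m (loop_series g (x - 1) *t loop_series h y)
    - Rk *m (loop_series g x *t loop_series h (y - 1))
  = loop_series h y *t loop_series g (x - 1) *m Rji
    - loop_series h (y - 1) *t loop_series g x *m Rj.
Proof.
move=> hg hh x y; set U := A *t 1%:M *m P m m *m Rm.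
have AP : A *t 1%:M *m P m m *m (A *t 1%:M *m P m m) = A *t A.
  by rewrite -mulmxA (mulmxA (P m m)) tens_swapMl -mulmxA tens_swapK mulmx1 tens_mx_decr.
have HXX : Rm *m (A *t 1%:M *m P m m *m (A *t 1%:M *m P m m))
           = A *t 1%:M *m P m m *m (A *t 1%:M *m P m m) *m Rm by rewrite AP rAA.
(* For an expansion at [0], [A] is invertible, hence so are [X Rm] and [Rm X], and their resolvents
   exist at the same point. *)
have inv s0 g0 : resolvent s0 A g0 ->
    (exists G, resolvent s0 U G)
    /\ exists K, resolvent s0 (Rm *m (A *t 1%:M *m P m m)) K.
  case=> _ _ _ inv; split; apply: resolvent_ex; case: inv => [|[B [BA AB]]];
    [by left | right | by left | right].
  - exists (Rmi *m (P m m *m (B *t 1%:M))); rewrite /U; split.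
      rewrite -!mulmxA (mulmxA (B *t _)) -tens_mxMl BA tens_mx1 mul1mx.
      by rewrite (mulmxA (P m m)) tens_swapK mul1mx (heckeVl hm).
    rewrite -!mulmxA (mulmxA Rm) (heckeV hm) mul1mx (mulmxA (P m m)) tens_swapK.
    by rewrite mul1mx -tens_mxMl AB tens_mx1.
  - exists (P m m *m (B *t 1%:M) *m Rmi); split.
      rewrite -!mulmxA (mulmxA Rmi) (heckeVl hm) mul1mx (mulmxA (B *t _)) -tens_mxMl.
      by rewrite BA tens_mx1 mul1mx tens_swapK.
    rewrite -!mulmxA (mulmxA (P m m)) tens_swapK mul1mx (mulmxA (A *t _)) -tens_mxMl.
    by rewrite AB tens_mx1 mul1mx (heckeV hm).
have [[G hG] [N hN]] := inv _ _ hg; have [[L hL] [K hK]] := inv _ _ hh.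
have main := hecke_resolvent clam hm HXX hG hN hL hK x y.
rewrite !(loop_series_tens hg hh hG hK) !(loop_series_tens hh hg hL hN).
(* Resolvents of the same [A] commute even when expanded at different points. *)
have gh u v : g u *m h v = h v *m g u.
  apply: (resolvent_comm hg); symmetry; exact: (resolvent_comm hh).
have AgH u v : h v *m A *m g u = g u *m A *m h v.
  rewrite (resolvent_comm hh (erefl (A *m A))) -mulmxA -gh mulmxA.
  by rewrite (resolvent_comm hg (erefl (A *m A))).
(* Regroup so that the inverse Hecke matrices stand on one side of the equation and the direct ones
   on the other. *)
rewrite !AgH; apply: subr_exchange.
rewrite (cross_inv _ _ _ _ _ _ _ rcc) ?(cross_dir _ _ _ _ _ _ _ rcc); try exact: central_nat.
congr (_ + _).
  (* Main terms: [rdd] and [raa] bring the Hecke matrices between [d (x) d] and [a (x) a], where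
     [main] applies. *)
  rewrite !(mulmxA Rki) !(mulmxA Rk) (hecke_conj hk hm rdd) rdd.
  rewrite -!(mulmxA _ (a *t a)) -raa -(hecke_conj hm hj raa) !mulmxA.
  rewrite -!mulmxBl -!(mulmxA (d *t d)) -!mulmxBr; congr (_ *m _ *m _).
  by move/subr_exchange: main; rewrite !mulmxA.
have SE b X Y : (b%:R : R) *: S X + S Y = S (b%:R *: X + Y).
  rewrite /S mulmxDr mulmxDl tens_mxDr !(central_scalemxr (@central_nat _ _)).
  by rewrite -!scalemxAl (central_tens_scaler (@central_nat _ _)).
rewrite !SE; have -> // : (y == 0)%:R *: g (x - 1) + g (x - 1) *m A *m h y
  = (x == 0)%:R *: h (y - 1) + g x *m A *m h (y - 1).
(* The recursion of [h] absorbs one delta and that of [g] the other, both giving the same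
   product. *)
transitivity (g (x - 1) *m h (y - 1)).
  rewrite (resolventl hh) mulmxDr mulmxA addrC.
  by rewrite (central_mul_mx_scalar (@central_nat _ _)).
by rewrite (resolventr hg) mulmxDl mul_scalar_mx addrC.
Qed.
End BlockRelations.

(** * The braided R-matrix in coordinates *)

Section BraidMatrix.
Variables (R : pzRingType) (q lam : R).

Definition kappa k (i j : 'I_k) : R := if i == j then q else 1.

(** The entries of [B = P R], over any ring and with [q], [lam] as separate parameters, so that it
    can be transported from the field to [Q]. *)
Definition braidmx k : 'M[R]_(k * k) :=
  \matrix_(r, s) let i := (mxtens_unindex r).1 in let j := (mxtens_unindex r).2 in
    kappa i j *+ (s == mxtens_index (j, i)) + lam *+ (i < j)%N *+ (s == r).

Lemma mul_braidmx k p (Z : 'M[R]_(k * k, p)) i j c :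
  (braidmx k *m Z) (mxtens_index (i, j)) c
  = kappa i j * Z (mxtens_index (j, i)) c
    + lam *+ (i < j)%N * Z (mxtens_index (i, j)) c.
Proof.
rewrite mxE; under eq_bigr => r _ do
  rewrite mxE mxtens_indexK /= mulrDl !mulrnAl !mulrb.
by rewrite big_split /= -!big_mkcond !big_pred1_eq mulrnAl mulrb.
Qed.

Lemma tr_braidmx k : (braidmx k)^T = braidmx k.
Proof.
apply: tens_matrixP => i j i' j'; rewrite !mxE !mxtens_indexK /=.
rewrite !(inj_eq (can_inj (@mxtens_indexK _ _))) !xpair_eqE.
congr (_ + _).
  rewrite [j == i']eq_sym [i == j']eq_sym andbC /kappa [i == j]eq_sym.
  by case: andP => // -[/eqP -> /eqP ->].
rewrite [i == i']eq_sym [j == j']eq_sym.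
by case: andP => // -[/eqP -> /eqP ->].
Qed.

Hypotheses (cq : central q) (clam : central lam).

Lemma mul_mx_braidmx k p (Z : 'M[R]_(p, k * k)) r i j :
  (Z *m braidmx k) r (mxtens_index (i, j))
  = kappa i j * Z r (mxtens_index (j, i))
    + lam *+ (i < j)%N * Z r (mxtens_index (i, j)).
Proof.
rewrite mxE -tr_braidmx; under eq_bigr => s _ do
  rewrite !mxE mxtens_indexK /= mulrDr !mulrnAr !mulrb.
rewrite big_split /= -!big_mkcond !big_pred1_eq.
rewrite mulrnAl -clam -mulrb; congr (_ + _).
by rewrite /kappa; case: eqP => _; rewrite ?cq // mulr1 mul1r.
Qed.

Lemma braidmx_hecke k : q * q = 1 + lam * q ->
  hecke lam (braidmx k) (braidmx k - lam%:M).
Proof.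
move=> qq; have HH : braidmx k *m braidmx k = 1%:M + lam *: braidmx k.
  (* With an arbitrary right factor [Z] in place of the identity, the row formula [mul_braidmx]
     evaluates every product. *)
  rewrite -[LHS]mulmx1 -[X in lam *: X]mulmx1 -mulmxA; move: 1%:M => Z.
  apply: tens_matrixP => i j i' j'.
  rewrite [RHS]mxE [X in _ = _ + X]mxE !mul_braidmx /kappa [j == i]eq_sym.
  case: (ltngtP i j) => [ltij|ltji|/val_inj ->].
  - by rewrite -(inj_eq val_inj) ltn_eqF //= !mulr1n !mulr0n !mul0r !mul1r !addr0.
  - by rewrite -(inj_eq val_inj) gtn_eqF //= !mulr1n !mulr0n !mul0r !mul1r !addr0.
  - by rewrite eqxx !mulr0n !mul0r !addr0 mulrA qq mulrDl mul1r mulrA.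
split.
- by rewrite mulmxBr HH central_mul_mx_scalar // addrK.
- by rewrite mulmxBl HH mul_scalar_mx addrK.
- by rewrite subrK.
Qed.

End BraidMatrix.

Lemma map_braidmx (R S : pzRingType) (f : {rmorphism R -> S}) q lam k :
  map_mx f (braidmx q lam k) = braidmx (f q) (f lam) k.
Proof.
apply/matrixP => r s; rewrite !mxE rmorphD !rmorphMn /= /kappa.
by rewrite (fun_if f) rmorph1.
Qed.

Lemma map_tens_swap (R S : pzRingType) (f : {rmorphism R -> S}) k l :
  map_mx f (tens_swap R k l) = tens_swap S k l.
Proof. by apply/matrixP => r s; rewrite !mxE rmorph_nat. Qed.

(** * Identification of [P R] and [P R^-T] *)

Section RMatrix.
Variables (C : fieldType) (q : C) (q0 : q != 0) (k : nat).
Let lam := q - q^-1.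

Lemma swap_Rmx : tens_swap C k k *m Rmx q k = braidmx q lam k.
Proof.
have sum_eq (i : 'I_k) (F : 'I_k -> C) : \sum_a (i == a)%:R * F a = F i.
  rewrite (bigD1 i) //= eqxx mul1r big1 ?addr0 // => a.
  by rewrite eq_sym => /negbTE ->; rewrite mul0r.
have sum_id : \sum_(i < k) \sum_(j < k) tensmx (delta_mx i i) (delta_mx j j)
    = 1%:M :> 'M[C]_(k * k).
  apply: tens_matrixP => i j i' j'; rewrite -tens_mx1 tensmxE !mxE summxE.
  under eq_bigr => a _ do (rewrite summxE; under eq_bigr => b _ do
    rewrite tensmxE !mxE -!mulnb !natrM -!mulrA mulrCA).
  under eq_bigr => a _ do rewrite -big_distrr -big_distrr /=.
  by rewrite !sum_eq [j' == _]eq_sym.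
have sum_diag i j i' j' :
    (\sum_(i < k) tensmx (delta_mx i i) (delta_mx i i) : 'M[C]_(k * k))
      (mxtens_index (i, j)) (mxtens_index (i', j'))
    = (i' == i)%:R * ((j == i)%:R * (j' == i)%:R).
  rewrite summxE; under eq_bigr => a _ do
    rewrite tensmxE !mxE -!mulnb !natrM -!mulrA.
  by rewrite sum_eq.
have sum_low i j i' j' :
    (\sum_(i < k) \sum_(j < k | (j < i)%N) tensmx (delta_mx i j) (delta_mx j i)
        : 'M[C]_(k * k))
      (mxtens_index (i, j)) (mxtens_index (i', j'))
    = ((j == i')%:R * (j' == i)%:R) *+ (i' < i)%N.
  rewrite summxE; under eq_bigr => a _ do
    (rewrite summxE big_mkcond; under eq_bigr => b _ do
      rewrite tensmxE !mxE -mulrb -!mulnb !natrM -!mulrA -mulrnAr).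
  under eq_bigr => a _ do rewrite -big_distrr /=.
  by rewrite sum_eq; under eq_bigr => b _ do rewrite -mulrnAr; rewrite sum_eq.
apply: tens_matrixP => i j i' j'; rewrite mul_tens_swap.
have mxD (X Y : 'M[C]_(k * k)) r s : (X + Y) r s = X r s + Y r s by rewrite mxE.
have mxZ x (X : 'M[C]_(k * k)) r s : (x *: X) r s = x * X r s by rewrite mxE.
rewrite /Rmx sum_id !mxD !mxZ sum_diag sum_low !mxE mxtens_indexK /=.
rewrite !(inj_eq (can_inj (@mxtens_indexK _ _))).
rewrite !xpair_eqE /kappa.
rewrite [i' == j]eq_sym [j' == i]eq_sym.
rewrite [i' == i]eq_sym [j' == j]eq_sym.
pose simp := (mulr0n, mulr1n, mulr0, mul0r, mulr1, mul1r, addr0, add0r, mul0rn).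
case: (eqVneq j i') => [<-|ne_ji']; case: (eqVneq i j') => [<-|ne_ij'] /=.
- by case: eqVneq => [->|_]; rewrite ?ltnn ?eqxx /= !simp // addrC subrK.
- by case: (eqVneq i j) ne_ij' => [->|_] /negbTE nij; rewrite ?ltnn ?nij /= !simp.
- by case: (eqVneq i j) => [->|_]; rewrite ?(negbTE ne_ji') /= ?andbF !simp.
- case: (eqVneq i i') => [->|_]; last by rewrite /= !simp.
  by case: (eqVneq j j') => [_|_]; rewrite /= !simp // mulr_natr.
Qed.

(** From [R = P B] one gets [R^-1 = B^-1 P]; transposing, with [P] and [B] symmetric, gives
    [R^-T = P B^-1]. *)
Lemma swap_RmxNT : tens_swap C k k *m RmxNT q k = braidmx q lam k - lam%:M.
Proof.
have qq : q * q = 1 + lam * q by rewrite mulrBl mulVf // addrC subrK.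
have cC (x : C) : central x by move=> y; rewrite mulrC.
have hB := braidmx_hecke (cC lam) k qq.
have RB : Rmx q k *m ((braidmx q lam k - lam%:M) *m tens_swap C k k) = 1%:M.
  rewrite -[Rmx q k](tens_swapKl) swap_Rmx -!mulmxA (mulmxA (braidmx _ _ _)).
  by rewrite (heckeV hB) mul1mx tens_swapK.
have [uR _] := mulmx1_unit RB.
rewrite /RmxNT -[invmx _]mulmx1 -RB mulKmx // trmx_mul tr_tens_swap tens_swapKl.
by rewrite linearB /= tr_braidmx tr_scalar_mx.
Qed.
End RMatrix.

(** * Block relations of the transport matrix *)

Section TransportBlocks.
Variables (R : pzRingType) (q lam : R) (cq : central q) (clam : central lam).
Variables (n1 m n2 : nat) (M : 'M[R]_(m + n2, n1 + m)).
Hypothesis RMM : braidmx q lam (m + n2) *m (M *t M) = M *t M *m braidmx q lam (n1 + m).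

Local Notation A := (ursubmx M).
Local Notation a := (ulsubmx M).
Local Notation c := (dlsubmx M).
Local Notation d := (drsubmx M).
Local Notation B k := (braidmx q lam k).
Local Notation P k l := (tens_swap R k l).

Lemma braid_entries i k j l :
  kappa q i k * (M k j * M i l) + lam *+ (i < k)%N * (M i j * M k l)
  = kappa q j l * (M i l * M k j) + lam *+ (j < l)%N * (M i j * M k l).
Proof.
have /matrixP/(_ (mxtens_index (i, k)) (mxtens_index (j, l))) := RMM.
by rewrite mul_braidmx mul_mx_braidmx // !tensmxE.
Qed.

Lemma lt_lrshift u v (i : 'I_u) (j : 'I_v) : (lshift v i < rshift u j)%N.
Proof. by rewrite /= ltn_addr. Qed.

Lemma lt_rlshift u v (i : 'I_u) (j : 'I_v) : (rshift u j < lshift v i)%N = false.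
Proof. by apply/negbTE; rewrite -leqNgt ltnW ?lt_lrshift. Qed.

Let simp := (lt_lrshift, lt_rlshift, eq_lshift, eq_rshift, eq_lrshift,
  eq_rlshift, ltn_add2l, mulr0n, mulr1n, mul0r, mul1r, addr0).

(** The arguments embed the row and column pairs. Mixed pairs are passed with the larger index
    first, so that their [lam] terms vanish. *)
Local Ltac block r1 r2 c1 c2 :=
  apply: tens_matrixP => i k j l;
  rewrite ?(mul_braidmx, mul_mx_braidmx, mul_tens_swap, mul_mx_tens_swap) //;
  rewrite !tensmxE !mxE;
  have := braid_entries (r1 i) (r2 k) (c1 j) (c2 l); rewrite /kappa !simp.

Lemma braid_UR_UR : B m *m (A *t A) = A *t A *m B m.
Proof. by block (@lshift m n2) (@lshift m n2) (@rshift n1 m) (@rshift n1 m). Qed.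

Lemma braid_UR_DR : P n2 m *m (A *t d) = d *t A *m B m.
Proof. by block (@rshift m n2) (@lshift m n2) (@rshift n1 m) (@rshift n1 m). Qed.

Lemma braid_UR_UL : B m *m (A *t a) = a *t A *m P n1 m.
Proof. by block (@lshift m n2) (@lshift m n2) (@rshift n1 m) (@lshift n1 m). Qed.

Lemma braid_UR_DL : P n2 m *m (A *t c) = c *t A *m P n1 m.
Proof. by block (@rshift m n2) (@lshift m n2) (@rshift n1 m) (@lshift n1 m). Qed.

(** The column pair is now increasing, so the right-hand [lam] term survives. *)
Lemma braid_UL_DR : P n2 m *m (a *t d) = d *t a *m P m n1 + lam *: (c *t A).
Proof.
apply: tens_matrixP => i k j l.
rewrite mul_tens_swap [RHS]mxE mul_mx_tens_swap [X in _ = _ + X]mxE !tensmxE !mxE.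
have := braid_entries (@rshift m n2 i) (@lshift m n2 k) (@lshift n1 m j) (@rshift n1 m l).
by rewrite /kappa !simp.
Qed.

Lemma braid_UL_DL : P n2 m *m (a *t c) = c *t a *m B n1.
Proof. by block (@rshift m n2) (@lshift m n2) (@lshift n1 m) (@lshift n1 m). Qed.

Lemma braid_DR_DL : B n2 *m (d *t c) = c *t d *m P n1 m.
Proof. by block (@rshift m n2) (@rshift m n2) (@rshift n1 m) (@lshift n1 m). Qed.

Lemma braid_DR_DR : B n2 *m (d *t d) = d *t d *m B m.
Proof. by block (@rshift m n2) (@rshift m n2) (@rshift n1 m) (@rshift n1 m). Qed.

Lemma braid_UL_UL : B m *m (a *t a) = a *t a *m B n1.
Proof. by block (@lshift m n2) (@lshift m n2) (@lshift n1 m) (@lshift n1 m). Qed.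

Lemma braid_DL_DL : B n2 *m (c *t c) = c *t c *m B n1.
Proof. by block (@rshift m n2) (@rshift m n2) (@lshift n1 m) (@lshift n1 m). Qed.

End TransportBlocks.

(** * Translation between tensor-factor notation and the braided form *)

Section BraidForm.
Variables (C : fieldType) (Q : unitAlgType C) (q : C) (q0 : q != 0).
Let lam := q - q^-1.
Local Notation f := (in_alg Q).
Local Notation B k := (braidmx (f q) (f lam) k).
Local Notation Bi k := (B k - (f lam)%:M).

Lemma central_in_alg (x : C) : central (in_alg Q x).
Proof. by move=> y; rewrite /= -scalerAl -scalerAr mul1r mulr1. Qed.

Lemma hecke_in_alg k : hecke (f lam) (B k) (Bi k).
Proof.
apply: braidmx_hecke (@central_in_alg _) _ _.
rewrite -2!(rmorphM f) -(rmorph1 f) -(rmorphD f); congr (f _).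
by rewrite mulrBl mulVf // addrC subrK.
Qed.

Lemma prod12E k l (X Y : 'M[Q]_(k, l)) : prod12 X Y = X *t Y.
Proof. exact: tens_mx_decr. Qed.

(** The entries of [Y] stand to the left of those of [X], so this is [Y (x) X] conjugated by
    flips. *)
Lemma prod21E k l (X Y : 'M[Q]_(k, l)) :
  prod21 Y X = tens_swap Q k k *m (Y *t X) *m tens_swap Q l l.
Proof.
rewrite -tens_mx_decr mulmxA tens_swapMl -(mulmxA _ (tens_swap Q k l)).
by rewrite tens_swapMr mulmxA tens_swapKr.
Qed.

Lemma swap_scalar_Rmx k : tens_swap Q k k *m scalar_entries Q (Rmx q k) = B k.
Proof. by rewrite -(map_tens_swap f) -map_mxM swap_Rmx // map_braidmx. Qed.

Lemma swap_scalar_RmxNT k : tens_swap Q k k *m scalar_entries Q (RmxNT q k) = Bi k.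
Proof.
rewrite -(map_tens_swap f) -map_mxM swap_RmxNT // map_mxB map_braidmx.
by rewrite map_scalar_mx.
Qed.

Lemma exchange_braid k l (U : 'M[C]_(k * k)) (V : 'M[C]_(l * l)) (X Y : 'M[Q]_(k, l)) :
  exchange U V X Y <->
  tens_swap Q k k *m scalar_entries Q U *m (X *t Y)
    = (Y *t X) *m (tens_swap Q l l *m scalar_entries Q V).
Proof.
rewrite /exchange prod12E prod21E; split=> [e | e].
  by rewrite -mulmxA e -!mulmxA tens_swapKl.
by rewrite -[LHS](tens_swapKl (l := k)) (mulmxA _ (scalar_entries Q U)) e !mulmxA.
Qed.

Lemma exchange_Rmx k l (X Y : 'M[Q]_(k, l)) :
  exchange (Rmx q k) (Rmx q l) X Y <-> B k *m (X *t Y) = (Y *t X) *m B l.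
Proof. by rewrite exchange_braid !swap_scalar_Rmx. Qed.

Lemma exchange_RmxNT k l (X Y : 'M[Q]_(k, l)) :
  exchange (RmxNT q k) (RmxNT q l) X Y <-> Bi k *m (X *t Y) = (Y *t X) *m Bi l.
Proof. by rewrite exchange_braid !swap_scalar_RmxNT. Qed.

Lemma loop_relation_braid k l (X Y : int -> 'M[Q]_(k, l)) :
  (forall x y, Bi k *m (X (x - 1) *t Y y) - B k *m (X x *t Y (y - 1))
             = (Y y *t X (x - 1)) *m Bi l - (Y (y - 1) *t X x) *m B l) ->
  loop_relation q X Y.
Proof.
move=> e x y; rewrite /mulRl /mulRr /mulu /mulv !prod12E !prod21E.
rewrite -!(mulmxA _ (tens_swap Q l l)) !swap_scalar_Rmx !swap_scalar_RmxNT.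
rewrite -!(mulmxA (tens_swap Q k k)) -mulmxBr -e mulmxBr.
by rewrite -swap_scalar_RmxNT -swap_scalar_Rmx -!mulmxA !tens_swapKl.
Qed.

End BraidForm.

(** * The loop elements as expansions of one rational expression *)

Section LoopSeries.
Variables (R : unitRingType) (n1 m n2 : nat).
Variables (a : 'M[R]_(m, n1)) (A : 'M[R]_m) (c : 'M[R]_(n2, n1)) (d : 'M[R]_(n2, m)).

Lemma Tplus_seriesE z : Tplus_series a A c d z = loop_series a c d (resp A) z.
Proof.
rewrite /loop_series; case: z => [[|k]|k] /=.
- by rewrite mulmx0 mul0mx addr0 scale1r.
- by rewrite mulmx0 mul0mx addr0 scale0r.
- by rewrite scale0r add0r.
Qed.

(** The sign and the shift express [T^-(u) = - u (c + d (u - A)^-1 a)] near [u = 0]; the constant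
    [c] accounts for the delta correction in [T^-_1]. *)
Lemma Tminus_seriesE (Ai : 'M[R]_m) z :
  Tminus_series a c d Ai z = - loop_series a c d (resm Ai) (z - 1).
Proof.
rewrite /loop_series; case: z => [[|[|k]]|k].
- by rewrite /= mulmx0 mul0mx addr0 scale0r oppr0.
- by rewrite subrr /= scale1r mulmxN mulNmx opprD opprK addrC.
- rewrite (_ : k.+2%:Z - 1 = k.+1%:Z) /=; last by lia.
  by rewrite scale0r add0r mulmxN mulNmx opprK /Tminus subr0.
- rewrite (_ : Negz k - 1 = Negz k.+1) /=; last by lia.
  by rewrite mulmx0 mul0mx addr0 scale0r oppr0.
Qed.

End LoopSeries.

Theorem theorem3p3 (K : realType) (q s : K[i]) (hq : q != 0) (hs : s ^+ 2 = q)
    (Q : unitAlgType K[i]) (n1 m n2 : nat)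
    (N : network (n1 + m) (m + n2)) (w : face N -> Q)
    (hw : face_variables s w)
    (M : 'M[Q]_(m + n2, n1 + m))
    (hM : is_transport_matrix s w M)
    (* standing input on quantum transport matrices *)
    (hRMM : exchange (Rmx q (m + n2)) (Rmx q (n1 + m)) M M)
    (M12i : 'M[Q]_m)
    (hinvr : ursubmx M *m M12i = 1%:M) (hinvl : M12i *m ursubmx M = 1%:M) :
  let M11 : 'M[Q]_(m, n1) := ulsubmx M in
  let M12 : 'M[Q]_m := ursubmx M in
  let M21 : 'M[Q]_(n2, n1) := dlsubmx M in
  let M22 : 'M[Q]_(n2, m) := drsubmx M in
  let Tp := Tplus M11 M12 M21 M22 in
  let Tm := Tminus M11 M21 M22 M12i in
  let Tp_u := Tplus_series M11 M12 M21 M22 in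
  let Tm_u := Tminus_series M11 M21 M22 M12i in
  (loop_relation q Tp_u Tp_u /\
   loop_relation q Tp_u Tm_u /\
   loop_relation q Tm_u Tm_u) /\
  (exchange (Rmx q n2) (Rmx q n1) (Tp 0%N) (Tp 0%N) /\
   exchange (RmxNT q n2) (RmxNT q n1) (Tp 0%N) (Tp 0%N) /\
   exchange (Rmx q n2) (Rmx q n1) (Tm 1%N) (Tp 0%N) /\
   exchange (Rmx q n2) (Rmx q n1) (Tm 1%N) (Tm 1%N) /\
   exchange (RmxNT q n2) (RmxNT q n1) (Tm 1%N) (Tm 1%N)).
Proof.
move=> M11 M12 M21 M22 Tp Tm Tp_u Tm_u.
have RMM := (exchange_Rmx q _ _).1 hRMM.
have cq := @central_in_alg _ Q q.
have cl := @central_in_alg _ Q (q - q^-1).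
have hH := @hecke_in_alg _ Q _ hq.
have rcc := braid_DL_DL cq cl RMM.
have loop := loop_exchange cl (hH m) (hH n2) (hH n1) (braid_UR_UR cq cl RMM)
    (braid_UR_DR cq cl RMM) (braid_UR_UL cq cl RMM) (braid_UR_DL cq cl RMM)
    (braid_UL_DR cq cl RMM) (braid_UL_DL cq cl RMM) (braid_DR_DL cq cl RMM)
    (braid_DR_DR cq cl RMM) (braid_UL_UL cq cl RMM) rcc.
have hp := respP M12; have hm := resmP hinvl hinvr.
have pp := loop _ _ _ _ hp hp.
have pm := loop _ _ _ _ hp hm.
have mm := loop _ _ _ _ hm hm.
have TpTp : loop_relation q Tp_u Tp_u.
  by apply: (loop_relation_braid hq) => x y; rewrite /Tp_u ?/Tm_u !Tplus_seriesE pp.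
have TpTm : loop_relation q Tp_u Tm_u.
  (* The shift in [T^-] only moves the exponent at which [pm] is used, and the sign is common to
     both sides. *)
  apply: (loop_relation_braid hq) => x y; rewrite /Tp_u ?/Tm_u !Tplus_seriesE !Tminus_seriesE.
  by rewrite !tens_mxNl !tens_mxNr !mulmxN !mulNmx -!opprD pm.
have TmTm : loop_relation q Tm_u Tm_u.
  apply: (loop_relation_braid hq) => x y; rewrite /Tm_u !Tminus_seriesE.
  by rewrite !tens_mxNl !tens_mxNr !opprK mm.
pose L z : 'M[Q]_(n2, n1) := loop_series M11 M21 M22 (resm M12i) z.
have Tm1 : Tm 1%N = - L 0 by have := Tminus_seriesE M11 M21 M22 M12i 1.
have cL : braidmx q%:A (q - q^-1)%:A n2 *m (L 0 *t M21)
          = (M21 *t L 0) *m braidmx q%:A (q - q^-1)%:A n1.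
  rewrite /L /loop_series eqxx scale1r tens_mxDl tens_mxDr mulmxDl mulmxDr rcc.
  rewrite (T0_c (hH n2) (braid_UR_DL cq cl RMM) (braid_UL_DL cq cl RMM)
    (braid_DR_DL cq cl RMM) hm) !mulmxA.
  by rewrite (heckeV (hH n2)) mul1mx.
have LL : braidmx q%:A (q - q^-1)%:A n2 *m (L 0 *t L 0)
          = (L 0 *t L 0) *m braidmx q%:A (q - q^-1)%:A n1.
  have L_N1 : L (- 1) = 0.
    by rewrite /L /loop_series /= mulmx0 mul0mx addr0 scale0r.
  (* At these exponents the inverse Hecke terms contain [L (- 1) = 0], and only the direct ones
     remain. *)
  have : _ *m (L (- 1) *t L 1) - _ *m (L 0 *t L 0)
         = (L 1 *t L (- 1)) *m _ - (L 0 *t L 0) *m _ := mm 0 1.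
  by rewrite L_N1 tens0mx tensmx0 mulmx0 mul0mx !sub0r => /oppr_inj.
split; [by split | split; [|split; [|split; [|split]]]].
- exact: (exchange_Rmx q _ _).2 rcc.
- exact: (exchange_RmxNT hq _ _).2 (hecke_conj (hH n2) (hH n1) rcc).
- apply: (exchange_Rmx q _ _).2 _.
  by rewrite Tm1 tens_mxNl tens_mxNr mulmxN mulNmx cL.
- apply: (exchange_Rmx q _ _).2 _.
  by rewrite Tm1 tens_mxNl tens_mxNr opprK LL.
- apply: (exchange_RmxNT hq _ _).2 _.
  by rewrite Tm1 tens_mxNl tens_mxNr opprK (hecke_conj (hH n2) (hH n1) LL).
Qed.
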